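(* Let $f:\mathbb R^n\to\mathbb R$ be locally Lipschitz, $C\subset\mathbb R^n$ closed convex, $\mathscr O$ a cutting plane oracle for $f$, and consider the inner loop (described in the context) at $x\in C$ with matrix $Q$. Suppose $Q\succ0$, the inner loop at $x$ turns infinitely (no trial step is ever accepted), and the trust-region radius $R_k$ stays bounded away from $0$. Suppose the $y^k$ are chosen as trial steps, i.e. $z^k=y^k$ for all $k$. Then $x$ is a critical point of $\min_{C}f$, i.e. $0\in\partial f(x)+N_C(x)$.
   Context: $\partial f$ is the Clarke subdifferential, $N_C$ the normal cone, $i_C$ the indicator function of $C$. $\|\cdot\|$ is a fixed norm on $\mathbb R^n$ (the trust-region norm), $B(x,r)$ the closed $\|\cdot\|$-ball. Cutting plane oracle. Fix $M>0$. A cutting plane oracle for $f$ is a set-valued operator $\mathscr O$ on $\mathbb R^n\times\mathbb R^n$ with values nonempty bounded subsets of $\mathbb R\times\mathbb R^n$, bounded on bounded sets; $(a,g)\in\mathscr O(z,x)$ represents the affine function $a+g^{\mathsf T}(\cdot-x)$. It satisfies: $(\mathscr O_1)$ if $(a,g)\in\mathscr O(z,x)$, then $a\le f(x)$; moreover $\mathscr O(x,x)$ contains at least one element $(f(x),g)$ with $g\in\partial f(x)$; $(\mathscr O_2)$ if $(a_j,g_j)\in\mathscr O(z_j,x)$, $a_j\to f(x)$, $\|z_j-x\|\le M$, $g_j\to g$, then $g\in\partial f(x)$; $(\mathscr O_3)$ if $z_j\to x$, there exist $(a_j,g_j)\in\mathscr O(z_j,x)$ and $\epsilon_j\to0^+$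 with $f(z_j)\le a_j+g_j^{\mathsf T}(z_j-x)+\epsilon_j\|z_j-x\|$; $(\mathscr O_4)$ if $z_j\to z$, $y_j\to y$, $x_j\to x$ with $\|z_j-x_j\|\le M$, and $(a_j,g_j)\in\mathscr O(z_j,x_j)$, then there exist $z'\in B(x,M)$ and $(a',g')\in\mathscr O(z',x)$ with $\limsup_j\,a_j+g_j^{\mathsf T}(y_j-x_j)\le a'+g'^{\mathsf T}(y-x)$. $M$ is understood to be large enough that all points $z$ at which the oracle is called in the inner loop at $x$ satisfy $\|z-x\|\le M$. Inner loop at $x\in C$ with symmetric $Q\succeq0$, $\|Q\|\le q$. Parameters $0<\gamma<\widetilde\gamma<1$, $0<\theta\ll1$, $\Theta\ge1$, $q>0$; initial radius $R_1>0$; $k=1$. At counter $k$ there is a first-order working model $\phi_k(\cdot,x)=\sup\{a+g^{\mathsf T}(\cdot-x):(a,g)\in\mathscr W_k\}$ and a second-order working model $\Phi_k(\cdot,x)=\phi_k(\cdot,x)+\frac12(\cdot-x)^{\mathsf T}Q(\cdot-x)$. $\mathscr W_1$ consists of oracle planes $(a,g)\in\mathscr O(z,x)$ and contains at least one exactness plane, i.e. some $(f(x),g)\in\mathscr O(x,x)$. (Trial step) Compute a solution $y^k$ of the tangent program: minimize $\Phi_k(y,x)$ subject to $y\in C$, $\|y-x\|\le R_k$. By optimality there is an aggregate subgradient $g_k^*\in\partial(\phi_k(\cdot,x)+i_C)(y^k)$ with $g_k^*+Q(y^k-x)+v_k=0$, $v_k$ in the normal cone to $B(x,R_k)$ at $y^k$;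 the aggregate plane is $m_k^*(\cdot,x)=\phi_k(y^k,x)+g_k^{*\mathsf T}(\cdot-y^k)$. A trial step is any $z^k\in C$ with $f(x)-\Phi_k(z^k,x)\ge\theta(f(x)-\Phi_k(y^k,x))$ and $\|z^k-x\|\le\Theta\|y^k-x\|$ (the choice $z^k=y^k$ is always allowed). (Acceptance) If $\rho_k=\frac{f(x)-f(z^k)}{f(x)-\Phi_k(z^k,x)}\ge\gamma$, then $z^k$ is accepted as new serious iterate and the inner loop ends. (Null step) Otherwise form $\mathscr W_{k+1}$ so that it contains at least one exactness plane $(f(x),g)\in\mathscr O(x,x)$, the aggregate plane $m_k^*$, and all of $\mathscr O(z^k,x)$; any further elements must belong to $\mathscr W_k$ (elements of $\mathscr W_k$ may be dropped). Compute $\widetilde\rho_k=\frac{f(x)-\phi_{k+1}(z^k,x)}{f(x)-\Phi_k(z^k,x)}$, put $R_{k+1}=R_k$ if $\widetilde\rho_k<\widetilde\gamma$, $R_{k+1}=\frac12R_k$ if $\widetilde\rho_k\ge\widetilde\gamma$, and increase $k$. *)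

(* Defs.v *)
From mathcomp Require Import all_boot all_order all_algebra.
From mathcomp Require Import all_classical all_reals all_analysis.
Import Order.TTheory GRing.Theory Num.Theory.
Import numFieldNormedType.Exports.

Set Implicit Arguments.
Unset Strict Implicit.
Unset Printing Implicit Defensive.

Local Open Scope classical_set_scope.
Local Open Scope ring_scope.

(* Vectors of R^n are rows 'rV[R]_n, with the library's (sup-norm) topology;
   the trust-region norm is a separate function N. Since all norms on R^n are
   equivalent, convergence and boundedness do not depend on this choice. *)

Section Vectors.
Variables (R : realType) (n : nat).
Implicit Types (u v d : 'rV[R]_n) (Q : 'M[R]_n).

Definition dot u v : R := (u *m v^T) 0 0.

Definition quad Q d : R := (d *m Q *m d^T) 0 0.

Definition posdef Q : Prop := Q^T = Q /\ forall d, d != 0 -> 0 < quad Q d.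

Record is_norm (N : 'rV[R]_n -> R) : Prop := IsNorm {
  norm_ge0 : forall u, 0 <= N u;
  norm_eq0 : forall u, N u = 0 -> u = 0;
  norm_scale : forall (t : R) u, N (t *: u) = `|t| * N u;
  norm_triangle : forall u v, N (u + v) <= N u + N v }.

Definition nball (N : 'rV[R]_n -> R) u (r : R) : set 'rV[R]_n :=
  [set v | N (v - u) <= r].

(* d *m Q^T is the row form of the column vector Q d. *)
Definition op_norm (N : 'rV[R]_n -> R) Q : R :=
  sup [set N (d *m Q^T) | d in [set d | N d <= 1]].

End Vectors.

Section NonsmoothAnalysis.
Variables (R : realType) (n : nat).
Local Notation V := 'rV[R]_n.

Definition locally_lipschitz (f : V -> R) : Prop :=
  forall x : V, exists2 U, nbhs x U &
    [lipschitz (f u : R^o) | u in U].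

(* f°(x; d) = limsup_{y -> x, t -> 0+} (f (y + t d) - f y) / t *)
Definition clarke_dd (f : V -> R) (x d : V) : \bar R :=
  limf_esup (fun p : V * R => ((f (p.1 + p.2 *: d) - f p.1) / p.2)%:E)
    (filter_prod (nbhs x) (0 : R)^'+).

Definition clarke_subdiff (f : V -> R) (x : V) : set V :=
  [set g | forall d : V, ((dot g d)%:E <= clarke_dd f x d)%E].

(* i_C, as an extended-real-valued function *)
Definition indic_fun (C : set V) (u : V) : \bar R :=
  if `[< C u >] then 0%E else +oo%E.

(* Used for phi_k + i_C, which is convex with values in ]-oo, +oo]: there the
   subdifferential is the one of convex analysis. *)
Definition convex_subdiff (h : V -> \bar R) (x : V) : set V :=
  [set g | h x \is a fin_num /\
     forall u : V, (h x + (dot g (u - x))%:E <= h u)%E].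

Definition normal_cone (C : set V) (x : V) : set V :=
  [set v | C x /\ forall u, C u -> dot v (u - x) <= 0].

(* 0 \in d f(x) + N_C(x) *)
Definition critical (f : V -> R) (C : set V) (x : V) : Prop :=
  [set g + v | g in clarke_subdiff f x & v in normal_cone C x] 0.

End NonsmoothAnalysis.

Section CuttingPlanes.
Variables (R : realType) (n : nat).
Local Notation V := 'rV[R]_n.

(* A pair (a, g) stands for the affine function y |-> a + g^T (y - x), where
   the base point x is always kept separately. *)
Definition plane : Type := (R * V)%type.

Definition eval_plane (x : V) (p : plane) (y : V) : R := p.1 + dot p.2 (y - x).

Record cutting_plane_oracle (N : V -> R) (M : R) (f : V -> R)
    (O : V -> V -> set (R * V)) : Prop := CuttingPlaneOracle {
  oracle_nonempty : forall z x, O z x !=set0;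
  oracle_bounded : forall z x, bounded_set (O z x);
  oracle_bounded_on_bounded : forall B : set (V * V),
    bounded_set B -> bounded_set (\bigcup_(zx in B) O zx.1 zx.2);
  oracle_below : forall z x a g, O z x (a, g) -> a <= f x;
  oracle_exact : forall x, exists2 g, O x x (f x, g) & clarke_subdiff f x g;
  oracle_O2 : forall (x g : V) (z_ : nat -> V) (a_ : nat -> R) (g_ : nat -> V),
    (forall j, O (z_ j) x (a_ j, g_ j)) ->
    a_ @ \oo --> f x ->
    (forall j, N (z_ j - x) <= M) ->
    g_ @ \oo --> g ->
    clarke_subdiff f x g;
  oracle_O3 : forall (x : V) (z_ : nat -> V),
    z_ @ \oo --> x ->
    exists (a_ : nat -> R) (g_ : nat -> V) (eps : nat -> R),
      [/\ forall j, O (z_ j) x (a_ j, g_ j),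
          forall j, 0 < eps j,
          eps @ \oo --> (0 : R) &
          forall j, f (z_ j) <=
            a_ j + dot (g_ j) (z_ j - x) + eps j * N (z_ j - x)];
  oracle_O4 : forall (z y x : V) (z_ y_ x_ : nat -> V)
      (a_ : nat -> R) (g_ : nat -> V),
    z_ @ \oo --> z -> y_ @ \oo --> y -> x_ @ \oo --> x ->
    (forall j, N (z_ j - x_ j) <= M) ->
    (forall j, O (z_ j) (x_ j) (a_ j, g_ j)) ->
    exists z' a' g', [/\ nball N x M z', O z' x (a', g') &
      (limn_esup (fun j => (a_ j + dot (g_ j) (y_ j - x_ j))%:E)
         <= (a' + dot g' (y - x))%:E)%E] }.

(* The sets W below are nonempty and bounded, so this real supremum is a true
   one. *)
Definition model1 (W : set plane) (x y : V) : R :=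
  sup [set eval_plane x p y | p in W].

Definition model2 (W : set plane) (Q : 'M[R]_n) (x y : V) : R :=
  model1 W x y + 2^-1 * quad Q (y - x).

Definition tangent_solution (N : V -> R) (C : set V) (W : set plane)
    (Q : 'M[R]_n) (x : V) (r : R) (y : V) : Prop :=
  [/\ C y, N (y - x) <= r &
      forall u, C u -> N (u - x) <= r -> model2 W Q x y <= model2 W Q x u].

(* g in d(phi_k(., x) + i_C)(y) with g + Q (y - x) + v = 0 for some v in the
   normal cone to the trust-region ball *)
Definition aggregate_subgradient (N : V -> R) (C : set V) (W : set plane)
    (Q : 'M[R]_n) (x : V) (r : R) (y g : V) : Prop :=
  convex_subdiff (fun u => (model1 W x u)%:E + indic_fun C u)%E y g /\
  exists2 v, normal_cone (nball N x r) y v & g + (y - x) *m Q^T + v = 0.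

(* y' |-> model1 W x y + g^T (y' - y), rewritten with base point x *)
Definition aggregate_plane (W : set plane) (x y g : V) : plane :=
  (model1 W x y + dot g (x - y), g).

Definition exactness_planes (f : V -> R) (O : V -> V -> set (R * V)) (x : V) :
    set plane :=
  [set p | p.1 = f x /\ O x x p].

Definition trial_step (N : V -> R) (f : V -> R) (C : set V) (W : set plane)
    (Q : 'M[R]_n) (theta Theta : R) (x y z : V) : Prop :=
  [/\ C z,
      f x - model2 W Q x z >= theta * (f x - model2 W Q x y) &
      N (z - x) <= Theta * N (y - x)].

Definition rho (f : V -> R) (W : set plane) (Q : 'M[R]_n) (x z : V) : R :=
  (f x - f z) / (f x - model2 W Q x z).

(* W is the current set of planes and W' the next one. *)
Definition rho_tilde (f : V -> R) (W W' : set plane) (Q : 'M[R]_n) (x z : V) :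
    R :=
  (f x - model1 W' x z) / (f x - model2 W Q x z).

Definition null_step_update (f : V -> R) (O : V -> V -> set (R * V))
    (x y z g : V) (W W' : set plane) : Prop :=
  [/\ exactness_planes f O x `&` W' !=set0,
      W' (aggregate_plane W x y g),
      O z x `<=` W' &
      W' `<=` exactness_planes f O x `|` [set aggregate_plane W x y g]
              `|` O z x `|` W].

(* The loop counter starts at 0 rather than 1. The bounds by M say that M is
   large enough for all calls to the oracle made by the loop. When
   model2 W Q x z = f x, the quotients rho and rho_tilde are 0 by the convention
   x / 0 = 0, so such a trial step counts as rejected. *)
Record infinite_inner_loop (N : V -> R) (M : R) (f : V -> R) (C : set V)
    (O : V -> V -> set (R * V)) (gamma gammat theta Theta : R)
    (Q : 'M[R]_n) (x : V)
    (r : nat -> R) (W : nat -> set plane) (y g z : nat -> V) : Prop :=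
  InfiniteInnerLoop {
  loop_radius0 : 0 < r 0%N;
  loop_W0_oracle : forall p, W 0%N p -> exists2 z', N (z' - x) <= M & O z' x p;
  loop_W0_exact : exactness_planes f O x `&` W 0%N !=set0;
  loop_tangent : forall k, tangent_solution N C (W k) Q x (r k) (y k);
  loop_aggregate : forall k,
    aggregate_subgradient N C (W k) Q x (r k) (y k) (g k);
  loop_trial : forall k, trial_step N f C (W k) Q theta Theta x (y k) (z k);
  loop_M : forall k, N (z k - x) <= M;
  loop_reject : forall k, ~ (rho f (W k) Q x (z k) >= gamma);
  loop_null_step : forall k,
    null_step_update f O x (y k) (z k) (g k) (W k) (W k.+1);
  loop_radius : forall k, r k.+1 =
    if rho_tilde f (W k) (W k.+1) Q x (z k) < gammat then r k else r k / 2 }.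

End CuttingPlanes.

(* Main.v *)
(* Write S_k for the value of the tangent program at y^k, phi_k for the first
   order model and P for the set of all planes the oracle can produce at x
   within distance M. The aggregate plane and Q > 0 give
   S_k + |y^(k+1) - y^k|_Q^2 / 2 <= S_(k+1) <= f(x); since the slopes of all
   planes are uniformly bounded, phi_(k+1)(y^k) - S_k is small whenever
   S_(k+1) - S_k is. As the radius cannot be halved forever, the test on
   rho-tilde then gives S_k -> f(x). On C every model lies below the envelope
   sup P, so f(x) <= sup P + |. - x|_Q^2 / 2 on C near x. Letting the point tend
   to x along a segment of C, axiom O2 produces for each u in C a Clarke
   subgradient g with g^T (u - x) >= 0, and a minimax argument makes g
   independent of u. *)

Require Import Defs.
From mathcomp Require Import all_boot all_order all_algebra.
From mathcomp Require Import all_classical all_reals all_analysis.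
From mathcomp Require Import ring lra.
Import Order.TTheory GRing.Theory Num.Theory.
Import numFieldNormedType.Exports.

Local Open Scope classical_set_scope.
Local Open Scope ring_scope.

(** * Lipschitz maps, the inner product and quadratic forms *)

Lemma dist_le_continuous {R : realType} {V W : normedModType R} (h : V -> W)
    (c : R) :
  0 <= c -> (forall u v, `|h u - h v| <= c * `|u - v|) -> continuous h.
Proof.
move=> c0 hc u; apply/cvgrPdist_le => e e0; near=> v.
rewrite (le_trans (hc _ _))// (@le_trans _ _ ((c + 1) * `|u - v|))//.
  by rewrite ler_wpM2r// lerDl.
rewrite mulrC -ler_pdivlMr ?ltr_wpDl//.
near: v; apply: (@cvgr_dist_le _ _ _ _ _ idfun); first exact: cvg_id.
by rewrite divr_gt0 ?ltr_wpDl.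
Unshelve. all: by end_near. Qed.

Section InnerProduct.
Context {R : realType} {n : nat}.
Implicit Types (u v w d : 'rV[R]_n) (Q : 'M[R]_n) (a : R).

Lemma dotE u v : dot u v = \sum_i u 0 i * v 0 i.
Proof. by rewrite /dot mxE; apply: eq_bigr => i _; rewrite mxE. Qed.

Lemma dotC u v : dot u v = dot v u.
Proof. by rewrite !dotE; apply: eq_bigr => i _; rewrite mulrC. Qed.

Lemma dotDl u v w : dot (u + v) w = dot u w + dot v w.
Proof. by rewrite /dot mulmxDl mxE. Qed.

Lemma dotDr u v w : dot w (u + v) = dot w u + dot w v.
Proof. by rewrite dotC dotDl !(dotC w). Qed.

Lemma dotNl u w : dot (- u) w = - dot u w.
Proof. by rewrite /dot mulNmx mxE. Qed.

Lemma dotNr u w : dot w (- u) = - dot w u.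
Proof. by rewrite dotC dotNl dotC. Qed.

Lemma dotBl u v w : dot (u - v) w = dot u w - dot v w.
Proof. by rewrite dotDl dotNl. Qed.

Lemma dotBr u v w : dot w (u - v) = dot w u - dot w v.
Proof. by rewrite dotDr dotNr. Qed.

Lemma dotZl a u w : dot (a *: u) w = a * dot u w.
Proof. by rewrite /dot -scalemxAl mxE. Qed.

Lemma dotZr a u w : dot w (a *: u) = a * dot w u.
Proof. by rewrite dotC dotZl dotC. Qed.

Lemma dot0r w : dot w 0 = 0.
Proof. by rewrite -(subrr w) dotBr subrr. Qed.

Definition dot_linear := (dotDl, dotDr, dotNl, dotNr, dotZl, dotZr).

Lemma coord_le_norm u i : `|u 0 i| <= `|u|.
Proof.
have -> : `|u| = mx_norm u by []; rewrite mx_normrE; apply/bigmax_geP; right => /=.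
by exists (0, i).
Qed.

(** The factor [n] is the price of measuring both vectors in the sup norm. *)
Lemma normr_dot_le u v : `|dot u v| <= n%:R * (`|u| * `|v|).
Proof.
rewrite dotE (le_trans (ler_norm_sum _ _ _))//.
have -> : n%:R * (`|u| * `|v|) = \sum_(i < n) `|u| * `|v|.
  by rewrite sumr_const card_ord mulr_natl.
by apply: ler_sum => i _; rewrite normrM ler_pM ?coord_le_norm.
Qed.

Lemma dot_le u v : dot u v <= n%:R * (`|u| * `|v|).
Proof. exact: le_trans (ler_norm _) (normr_dot_le u v). Qed.

Lemma sqr_norm_le_dot u : `|u| ^+ 2 <= dot u u.
Proof.
have dot_ge0 v : 0 <= dot v v.
  by rewrite dotE sumr_ge0// => i _; rewrite -expr2 sqr_ge0.
have [->|u0] := eqVneq u 0; first by rewrite normr0 expr0n dot_ge0.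
have : mx_norm u != 0 by apply: contra_neq u0 => /mx_norm_eq0.
case/mx_norm_neq0 => -[i j] /= uE.
have -> : `|u| = mx_norm u by []; rewrite uE (ord1 i) -normrX ger0_norm ?sqr_ge0//.
rewrite dotE (bigD1 j)//= -expr2 lerDl sumr_ge0// => k _.
by rewrite -expr2 sqr_ge0.
Qed.

Lemma dot_ge0 u : 0 <= dot u u.
Proof. exact: le_trans (sqr_ge0 _) (sqr_norm_le_dot u). Qed.

Lemma dot_eq0 u : dot u u <= 0 -> u = 0.
Proof.
move=> u0; apply/eqP; rewrite -normr_eq0 -sqrf_eq0 eq_le sqr_ge0 andbT.
exact: le_trans (sqr_norm_le_dot u) u0.
Qed.

Lemma coord_cvg {T : Type} (F : set_system T) {FF : Filter F}
    (u_ : T -> 'rV[R]_n) u i : u_ @ F --> u -> u_ t 0 i @[t --> F] --> u 0 i.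
Proof. by move=> cu; exact: (cvg_comp _ _ cu (@coord_continuous R 1 n 0 i u)). Qed.

Lemma cvg_dot {T : Type} (F : set_system T) {FF : Filter F}
    (u_ v_ : T -> 'rV[R]_n) u v :
  u_ @ F --> u -> v_ @ F --> v -> dot (u_ t) (v_ t) @[t --> F] --> dot u v.
Proof.
move=> cu cv; rewrite dotE (_ : (fun t => _) = fun t => \sum_i u_ t 0 i * v_ t 0 i).
  by apply: (cvg_big add_continuous) => i _; apply: cvgM; exact: coord_cvg.
by apply/funext => t; rewrite dotE.
Qed.

Lemma quadE Q d : quad Q d = dot (d *m Q) d.
Proof. by []. Qed.

Lemma quadZ Q a d : quad Q (a *: d) = a ^+ 2 * quad Q d.
Proof. by rewrite !quadE -scalemxAl dotZl dotZr mulrA. Qed.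

Lemma quad0 Q : quad Q 0 = 0.
Proof. by rewrite quadE dot0r. Qed.

Lemma dot_mulmx_sym Q u v : Q^T = Q -> dot (u *m Q) v = dot (v *m Q) u.
Proof.
move=> QT; rewrite [RHS]dotC /dot trmx_mul QT mulmxA; congr ((_ *m _) 0 0).
Qed.

Lemma quadD Q u v : Q^T = Q ->
  quad Q (u + v) = quad Q u + 2 * dot (u *m Q) v + quad Q v.
Proof.
move=> QT; rewrite !quadE mulmxDl dotDl !dotDr (@dot_mulmx_sym _ v u QT); ring.
Qed.

Lemma quad_continuous Q : continuous (quad Q).
Proof.
have E d : quad Q d = \sum_j dot d (col j Q)^T * d 0 j.
  by rewrite quadE dotE; apply: eq_bigr => j _; rewrite /dot trmxK !mxE;
    congr (_ * _); apply: eq_bigr => i _; rewrite !mxE.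
rewrite (_ : quad Q = fun d => \sum_j dot d (col j Q)^T * d 0 j); last exact/funext.
apply: (continuous_big add_continuous) => i _ d.
have cd : {for d, continuous (fun d => dot d (col i Q)^T)}.
  exact: (@cvg_dot _ (nbhs d) _ id (fun=> _) _ _ cvg_id (cvg_cst _)).
exact: (continuousM cd (@coord_continuous R 1 n 0 i d)).
Qed.

(* By homogeneity it is enough to minimise h over the (compact) unit sphere. *)
Lemma homogeneous_coercive (h : 'rV[R]_n -> R) (p : nat) :
  continuous h -> (forall a u, h (a *: u) = `|a| ^+ p * h u) ->
  (forall u, u != 0 -> 0 < h u) ->
  exists2 c, 0 < c & forall u, u != 0 -> c * `|u| ^+ p <= h u.
Proof.
move=> hcont hZ hpos.
pose S := [set u : 'rV[R]_n | `|u| = 1].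
have [S0|/set0P S0] := eqVneq S set0.
  (* An empty unit sphere means that there is no nonzero vector, so any constant will do. *)
  exists 1 => // u u0; exfalso.
  suff : S (`|u|^-1 *: u) by rewrite S0.
  by rewrite /S/= normrZ normfV normr_id mulVf// normr_eq0.
have cS : compact S.
  apply: bounded_closed_compact.
    exists 1; split => // a a1 u /= ->; exact: ltW.
  rewrite (_ : S = (fun u : 'rV[R]_n => `|u|) @^-1` [set 1])//.
  apply: preimage_closed; first by move=> u _; exact: norm_continuous.
  exact: closed_eq.
have [|c /set_mem Sc cmin] := EVT_min_rV S0 cS (f := h).
  exact: continuous_subspaceT.
have c0 : c != 0 by rewrite -normr_eq0 Sc oner_neq0.
exists (h c); first exact: hpos.
move=> u u0; have nu : `|u| != 0 by rewrite normr_eq0.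
have : h c <= h (`|u|^-1 *: u).
  by apply/cmin/mem_set; rewrite /S/= normrZ normfV normr_id mulVf.
rewrite hZ normfV normr_id exprVn => /(ler_wpM2l (exprn_ge0 p (normr_ge0 u))).
by rewrite mulrA mulfV ?mul1r 1?mulrC// expf_neq0.
Qed.

End InnerProduct.

(** * Equivalence of norms and coercivity of definite forms *)

Lemma seminorm_le_sup {R : realType} {n} {p : 'rV[R]_n -> R} :
  (forall u, 0 <= p u) -> (forall (a : R) u, p (a *: u) = `|a| * p u) ->
  (forall u v, p (u + v) <= p u + p v) ->
  exists2 c, 0 <= c & forall u, p u <= c * `|u|.
Proof.
(* The constant comes from expanding [u] in the standard basis. *)
move=> p_ge0 pZ pD; exists (\sum_i p (delta_mx 0 i)); first by apply: sumr_ge0.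
move=> u; rewrite {1}(row_sum_delta u) mulr_suml.
have p0 : p 0 = 0 by rewrite -(scale0r 0) pZ normr0 mul0r.
elim/big_ind2 : _ => [|v a w b va wb|i _]; first by rewrite p0.
  by rewrite (le_trans (pD _ _))// lerD.
by rewrite pZ mulrC ler_wpM2l// coord_le_norm.
Qed.

Lemma norm_mulmx_le {R : realType} {n} (A : 'M[R]_n) :
  exists2 c, 0 <= c & forall u : 'rV[R]_n, `|u *m A| <= c * `|u|.
Proof.
apply: seminorm_le_sup => [//|a u|u v]; first by rewrite -scalemxAl normrZ.
by rewrite mulmxDl ler_normD.
Qed.

Section Norm.
Context {R : realType} {n : nat} {N : 'rV[R]_n -> R}.
Hypothesis hN : is_norm N.

Lemma norm_le_sup : exists2 c, 0 <= c & forall u, N u <= c * `|u|.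
Proof.
apply: seminorm_le_sup; [exact: norm_ge0|exact: norm_scale|exact: norm_triangle].
Qed.

Lemma is_norm_continuous : continuous N.
Proof.
have [c c0 Nc] := norm_le_sup.
apply: (@dist_le_continuous _ _ R^o _ c) => // u v.
have lip a b : N a - N b <= c * `|a - b|.
  rewrite lerBlDr (le_trans _ (lerD (Nc _) (lexx _)))//.
  by rewrite (le_trans _ (norm_triangle hN _ _))// subrK.
by rewrite ler_norml lip lerNl opprB distrC lip.
Qed.

Lemma sup_le_norm : exists2 c, 0 < c & forall u, c * `|u| <= N u.
Proof.
have N0 : N 0 = 0 by rewrite -(scale0r 0) (norm_scale hN) normr0 mul0r.
have [|u u0|c c0 cN] := @homogeneous_coercive _ _ N 1 is_norm_continuous.
- by move=> a u; rewrite expr1 (norm_scale hN).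
- rewrite lt_neqAle (norm_ge0 hN) andbT eq_sym.
  by apply: contra_neq u0 => /(norm_eq0 hN).
- exists c => // u; have [->|/cN] := eqVneq u 0; last by rewrite expr1.
  by rewrite normr0 mulr0 N0.
Qed.

End Norm.

Lemma posdef_coercive {R : realType} {n} {Q : 'M[R]_n} : posdef Q ->
  exists2 c, 0 < c & forall u, c * `|u| ^+ 2 <= quad Q u.
Proof.
move=> [_ Qpos].
have [||c c0 cQ] := @homogeneous_coercive _ _ (quad Q) 2 (@quad_continuous _ _ Q).
- by move=> a u; rewrite quadZ real_normK ?num_real.
- exact: Qpos.
- exists c => // u; have [->|/cQ//] := eqVneq u 0.
  by rewrite normr0 expr0n mulr0 quad0.
Qed.

(** This stands for letting the step length tend to 0 in a first order condition; for [0 < a] the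
    step [a / (a + b)] already contradicts the bound. *)
Lemma le0_of_le_small {R : realType} (a b : R) :
  (forall s, 0 < s -> s <= 1 -> a <= s * b) -> a <= 0.
Proof.
move=> ab; rewrite leNgt; apply/negP => a0.
have b0 : 0 < b by have := ab 1 ltr01 (lexx _); lra.
have := ab (a / (a + b)) (divr_gt0 a0 (addr_gt0 a0 b0)).
rewrite ler_pdivrMr ?addr_gt0// mul1r lerDl (ltW b0) => /(_ isT).
rewrite mulrAC ler_pdivlMr ?addr_gt0// mulrDr; nra.
Qed.

(** * Projections, a minimax selection, compactness and the Clarke subdifferential *)

Section Convex.
Context {R : realType} {n : nat}.
Implicit Types (C G : set 'rV[R]_n) (u v w x p g : 'rV[R]_n).

(** Convexity as a step of length [t] from [u] towards [w], the form that first order conditions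
    use. *)
Definition segment_convex C : Prop :=
  forall u w (t : R), C u -> C w -> 0 <= t -> t <= 1 -> C (u + t *: (w - u)).

Lemma convex_set_segment C :
  convex_set (C : set (convex_lmodType 'rV[R]_n)) -> segment_convex C.
Proof.
move=> cC u w t Cu Cw t0 t1.
have := cC w u (Itv01 t0 t1); rewrite !inE => /(_ Cw Cu).
rewrite (_ : u + _ = t *: w + (1 - t) *: u)//.
by rewrite scalerBr scalerBl scale1r addrC -addrA (addrC (- _)).
Qed.

Lemma compact_norm_ball (L : R) : compact [set g : 'rV[R]_n | `|g| <= L].
Proof.
apply: bounded_closed_compact.
  exists L; split; [exact: num_real|move=> a La u /= uL].
  exact: le_trans uL (ltW La).
rewrite (_ : [set _ | _] = (fun u : 'rV[R]_n => `|u|) @^-1` [set a | a <= L])//.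
apply: preimage_closed; first by move=> u _; exact: norm_continuous.
exact: closed_le.
Qed.

Lemma dot_sub_continuous p : continuous (fun u => dot (u - p) (u - p)).
Proof.
move=> d.
have cB : u - p @[u --> nbhs d] --> d - p.
  exact: (cvgB cvg_id (cvg_cst _)).
exact: (@cvg_dot _ _ _ (nbhs d) _ _ _ _ _ cB cB).
Qed.

(** The point [u] minimises the squared Euclidean distance to [p]; the inequality is the first order
    condition along the segment from [u] to [w]. *)
Lemma exists_projection C p : closed C -> C !=set0 -> segment_convex C ->
  exists2 u, C u & forall w, C w -> dot (p - u) (w - u) <= 0.
Proof.
move=> cC [u0 Cu0] sC.
pose h u := dot (u - p) (u - p).
pose A := C `&` h @^-1` [set a | a <= h u0].
have A0 : A !=set0 by exists u0; split => //=.
have cA : compact A.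
  apply: bounded_closed_compact.
    (* The bound [a ^+ 2 <= h u0] yields [a <= h u0 + 1], which avoids a square root. *)
    exists (`|p| + (h u0 + 1)); split; [exact: num_real|move=> a La u [_ /= uh]].
    apply: le_trans (ltW La); rewrite -{1}(subrK p u) addrC.
    rewrite (le_trans (ler_normD _ _))// lerD2l.
    have := le_trans (sqr_norm_le_dot (u - p)) uh.
    have : 0 <= h u0 by exact: dot_ge0.
    by have := normr_ge0 (u - p); nra.
  apply: closedI => //; apply: preimage_closed; last exact: closed_le.
  by move=> u _; exact: dot_sub_continuous.
have [|u /set_mem[Cu _] umin] := EVT_min_rV A0 cA (f := h).
  by apply: continuous_subspaceT; exact: dot_sub_continuous.
have {}umin w : C w -> h u <= h w.
  move=> Cw; have [wu0|/ltW wu0] := leP (h w) (h u0).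
    by apply/umin/mem_set; split.
  by apply: le_trans wu0; apply/umin/mem_set; split => /=.
exists u => // w Cw.
suff : 2 * dot (p - u) (w - u) <= 0 by lra.
apply: (@le0_of_le_small _ _ (dot (w - u) (w - u))) => s s0 s1.
have := umin _ (sC u w s Cu Cw (ltW s0) s1).
rewrite /h (_ : u + _ - p = s *: (w - u) - (p - u)); last first.
  by rewrite opprB addrA [in RHS]addrC addrCA addrA addrC addrA.
rewrite -(opprB p u).
move: (p - u) (w - u) => a b.
rewrite !dot_linear (dotC b a) => H.
by rewrite -(ler_pM2l s0); nra.
Qed.

(* With [u g] the projection of [x - g] on [C], the gap function
   [theta g := max_(w in C) (- g . (w - x) - |w - x|^2 / 2)] is attained at
   [w = u g], and vanishes iff [- g] is normal to [C] at [x]. The first order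
   condition at a minimiser of [theta] over [G] forces it to vanish. *)
Lemma normal_selection C G x :
  closed C -> segment_convex C -> C x -> compact G -> segment_convex G ->
  (forall u, C u -> exists2 g, G g & 0 <= dot g (u - x)) ->
  exists2 g, G g & normal_cone C x (- g).
Proof.
move=> cC sC Cx cG sG CG.
have C0 : C !=set0 by exists x.
have /choice[P PP] : forall g, exists u, C u /\
    forall w, C w -> dot (x - g - u) (w - u) <= 0.
  by move=> g; have [u Cu uP] := exists_projection C (x - g) cC C0 sC; exists u.
have PC g : C (P g) by have [] := PP g.
have PVI g w : C w -> dot (x - g - P g) (w - P g) <= 0 by have [_] := PP g; exact.
(* Adding the variational inequalities at [P g] and [P g'] gives [dot D D <= dot (g' - g) D] for
   [D = P g - P g']. *)
have Plip g g' : `|P g - P g'| <= n%:R * `|g - g'|.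
  have := PVI g _ (PC g'); have := PVI g' _ (PC g).
  have := sqr_norm_le_dot (P g - P g').
  have := dot_le (g' - g) (P g - P g').
  rewrite (distrC g').
  have -> : x - g' - P g' = (x - g - P g) + (P g - P g') + (g - g').
    by apply/rowP => i; rewrite !mxE; ring.
  rewrite -(opprB (P g) (P g')); move: (P g - P g') => D; set a := x - g - P g.
  rewrite -[g' - g]opprB; move: (g - g') => e.
  rewrite !dot_linear => h1 h2 h3 h4.
  have [->|D0] := eqVneq D 0; first by rewrite normr0 mulr_ge0.
  rewrite -(ler_pM2r (_ : 0 < `|D|)) ?normr_gt0// -mulrA -expr2; lra.
have Pcont : continuous P.
  exact: (@dist_le_continuous _ _ _ _ n%:R).
pose psi g w := - dot g (w - x) - 2^-1 * dot (w - x) (w - x).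
pose theta g := psi g (P g).
(* Completing the square: [theta g - psi g w] equals [- dot (x - g - P g) (w - P g)] plus half the
   squared Euclidean length of [w - P g]. *)
have psi_le g w : C w -> psi g w <= theta g.
  move=> Cw; have := PVI g _ Cw; have := dot_ge0 (w - P g).
  rewrite /theta /psi.
  have -> : x - g - P g = - (P g - x) - g by apply/rowP => i; rewrite !mxE; ring.
  have -> : w - x = (P g - x) + (w - P g) by apply/rowP => i; rewrite !mxE; ring.
  move: (P g - x) (w - P g) => a b.
  rewrite !dot_linear (dotC b a); lra.
have theta_cont : continuous theta.
  move=> g.
  have cP : P h - x @[h --> nbhs g] --> P g - x.
    exact: (cvgB (Pcont g) (cvg_cst _)).
  have c1 := @cvg_dot _ _ _ _ (nbhs_filter g) _ _ _ _ cvg_id cP.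
  have c2 := @cvg_dot _ _ _ _ (nbhs_filter g) _ _ _ _ cP cP.
  exact: (cvgB (cvgN c1) (cvgM (cvg_cst (2^-1 : R)) c2)).
have [g1 Gg1 _] := CG x Cx.
have [||g0 /set_mem Gg0 g0min] := EVT_min_rV _ cG (f := theta).
- by exists g1.
- exact: continuous_subspaceT.
exists g0 => //.
have [g Gg g_ge0] := CG _ (PC g0).
(* Danskin's argument: minimality of [theta] at [g0] gives the sign at [P gs] for [gs] on the
   segment towards [g], and the Lipschitz bound on [P] carries it to [P g0] up to an error of order
   [s]. *)
have gg0 : dot (g - g0) (P g0 - x) <= 0.
  apply: (@le0_of_le_small _ _ (n%:R * (`|g - g0| * (n%:R * `|g - g0|)))).
  move=> s s0 s1.
  set gs := g0 + s *: (g - g0).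
  have Ggs : G gs by apply: sG => //; exact: ltW.
  have h1 := g0min gs (mem_set Ggs).
  have h2 := psi_le g0 _ (PC gs).
  have h3 : theta gs = psi g0 (P gs) - s * dot (g - g0) (P gs - x).
    by rewrite /theta /psi {1}/gs dotDl dotZl; ring.
  have h4 : dot (g - g0) (P gs - x) <= 0 by rewrite -(pmulr_rle0 _ s0); lra.
  have h5 := dot_le (g - g0) (P g0 - P gs).
  have h6 : `|P g0 - P gs| <= s * (n%:R * `|g - g0|).
    rewrite (le_trans (Plip _ _))// distrC /gs addrC addKr normrZ gtr0_norm//.
    by rewrite mulrCA.
  have -> : P g0 - x = (P g0 - P gs) + (P gs - x) by rewrite addrA subrK.
  rewrite dotDr -[leRHS]addr0 lerD// (le_trans h5)//.
  by rewrite [leRHS]mulrCA ler_wpM2l// [leRHS]mulrCA ler_wpM2l.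
(* Now [dot g0 (P g0 - x) >= dot g (P g0 - x) >= 0], while [theta g0 >= psi g0 x = 0]; this forces
   the squared distance from [P g0] to [x] to vanish. *)
have Pg0 : P g0 = x.
  apply/subr0_eq/dot_eq0.
  have := psi_le g0 _ Cx; rewrite /theta /psi subrr !dot0r mulr0 subr0 oppr0.
  by move: gg0; rewrite dotBl; lra.
split => // w Cw; have := PVI g0 _ Cw.
by rewrite Pg0 addrAC subrr add0r.
Qed.

(** A cluster point is approached within [1 / (m + 1)] at some index [s m] beyond [m]; [s] need not
    be increasing for limits at infinity to carry over. *)
Lemma bounded_seq_cvg_subseq (u_ : nat -> 'rV[R]_n) (L : R) :
  (forall j, `|u_ j| <= L) ->
  exists (s : nat -> nat) (l : 'rV[R]_n), (forall m, m <= s m)%N /\ u_ (s m) @[m --> \oo] --> l.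
Proof.
move=> uL.
have [|l [_ ul]] := @compact_norm_ball L (u_ @ \oo) _.
  by exists 0%N => //= j _; exact: uL.
have /choice[s sP] m : exists j, (m <= j)%N /\ `|l - u_ j| < m.+1%:R^-1.
  have [||_ [[j /= mj <-] jl]] := ul [set u_ j | j in [set j | (m <= j)%N]]
      (ball l m.+1%:R^-1).
  - by exists m => //= j mj; exists j.
  - exact: nbhsx_ballx.
  - by exists j; split => //; move: jl; rewrite -ball_normE.
exists s, l; split=> [m|]; first by have [] := sP m.
apply/cvgrPdist_le => e e0; near=> m.
apply/ltW/(lt_trans (sP m).2).
by near: m; exact: near_infty_natSinv_lt (PosNum e0).
Unshelve. all: by end_near. Qed.

(** An intersection of closed half-spaces; infinite values of [clarke_dd] contribute the whole space
    or the empty set. *)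
Lemma clarke_subdiff_closed (f : 'rV[R]_n -> R) x : closed (clarke_subdiff f x).
Proof.
rewrite (_ : clarke_subdiff f x = \bigcap_d
    [set g | ((dot g d)%:E <= clarke_dd f x d)%E]); last first.
  by apply/seteqP; split => g /= gx d; [move=> _|]; exact: gx.
apply: closed_bigI => d _; case: (clarke_dd f x d) => [a| |].
- rewrite (_ : [set _ | _] = (fun g => dot g d) @^-1` [set b | b <= a]); last first.
    by apply/seteqP; split => g /=; rewrite lee_fin.
  apply: preimage_closed; last exact: closed_le.
  move=> g _; exact: (@cvg_dot _ _ _ (nbhs g) _ id (fun=> d) _ _ cvg_id (cvg_cst _)).
- rewrite (_ : [set _ | _] = setT); last by apply/seteqP; split => g //= _; exact: leey.
  exact: closedT.
- rewrite (_ : [set _ | _] = set0); last by apply/seteqP; split => g //=; rewrite leeNy_eq.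
  exact: closed0.
Qed.

Lemma clarke_subdiff_convex (f : 'rV[R]_n -> R) x :
  segment_convex (clarke_subdiff f x).
Proof.
move=> g h t cg ch t0 t1 d; have := cg d; have := ch d.
case: (clarke_dd f x d) => [a| |]; [|by move=> _ _; exact: leey|by []].
rewrite !lee_fin !dot_linear; nra.
Qed.

End Convex.

(** * Cutting plane models and aggregate planes *)

Section Models.
Context {R : realType} {n : nat}.
Implicit Types (W : set (plane R n)) (x y u g : 'rV[R]_n).

Lemma model1_ge W x u p :
  has_ubound [set eval_plane x p u | p in W] -> W p ->
  eval_plane x p u <= model1 W x u.
Proof. by move=> ub Wp; apply: ub_le_sup => //; exists p. Qed.

Lemma model1_le W x u (b : R) :
  W !=set0 -> (forall p, W p -> eval_plane x p u <= b) -> model1 W x u <= b.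
Proof.
move=> [p Wp] Wb; apply: ge_sup; first by exists (eval_plane x p u), p.
by move=> _ [q Wq <-]; exact: Wb.
Qed.

Lemma eval_plane_base x (p : plane R n) : eval_plane x p x = p.1.
Proof. by rewrite /eval_plane subrr dot0r addr0. Qed.

Lemma eval_planeB x (p : plane R n) u y :
  eval_plane x p u = eval_plane x p y + dot p.2 (u - y).
Proof. by rewrite /eval_plane !dotBr; ring. Qed.

Lemma eval_aggregate_plane W x y g u :
  eval_plane x (aggregate_plane W x y g) u = model1 W x y + dot g (u - y).
Proof. by rewrite /eval_plane /aggregate_plane /= !dotBr; ring. Qed.

Lemma aggregate_plane_le W (C : set 'rV[R]_n) x y g u :
  convex_subdiff (fun u => (model1 W x u)%:E + indic_fun C u)%E y g ->
  C y -> C u -> eval_plane x (aggregate_plane W x y g) u <= model1 W x u.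
Proof.
move=> [_ /(_ u)] + Cy Cu.
by rewrite /indic_fun !asboolT// !adde0 -EFinD lee_fin eval_aggregate_plane.
Qed.

End Models.

(** * The envelope of all oracle planes at a point *)

Section OracleEnvelope.
Context {R : realType} {n : nat} {N : 'rV[R]_n -> R} (hN : is_norm N)
  {M : R} {f : 'rV[R]_n -> R} {O : 'rV[R]_n -> 'rV[R]_n -> set (R * 'rV[R]_n)}
  (hO : cutting_plane_oracle N M f O).
Implicit Types x d : 'rV[R]_n.

Definition oracle_planes x : set (plane R n) :=
  [set p | exists2 z, N (z - x) <= M & O z x p].

Lemma oracle_planes_bounded x : exists2 L, 0 <= L &
  forall p, oracle_planes x p -> `|p.1| <= L /\ `|p.2| <= L.
Proof.
have [c c0 cN] := sup_le_norm hN.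
pose B := [set zx : 'rV[R]_n * 'rV[R]_n | N (zx.1 - x) <= M /\ zx.2 = x].
have : bounded_set B.
  exists (`|x| + M / c); split; first exact: num_real.
  move=> a La [z _] [/= zM ->]; apply: le_trans (ltW La).
  have zx : `|z - x| <= M / c.
    by rewrite ler_pdivlMr// mulrC (le_trans (cN _)).
  have M0 : 0 <= M / c := le_trans (normr_ge0 _) zx.
  rewrite prod_normE/= ge_max lerDl M0 andbT -{1}(subrK x z) addrC.
  by rewrite (le_trans (ler_normD _ _))// lerD2l.
move=> /(oracle_bounded_on_bounded hO)/ex_strict_bound_gt0[L L0 LP].
exists L => [|p [z zM Op]]; first exact: ltW.
have /ltW : `|p| < L by apply: LP; exists (z, x).
by rewrite prod_normE ge_max => /andP[].
Qed.

Lemma oracle_planes_eval_bounded x u :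
  has_ubound [set eval_plane x p u | p in oracle_planes x].
Proof.
have [L L0 LP] := oracle_planes_bounded x.
exists (L + n%:R * (L * `|u - x|)) => _ [p /LP[p1 p2] <-].
rewrite lerD ?(le_trans (ler_norm _) p1)// (le_trans (dot_le _ _))//.
by rewrite ler_wpM2l// ler_wpM2r.
Qed.

Lemma oracle_planes_nonempty x : 0 <= M -> oracle_planes x !=set0.
Proof.
move=> M0; have [g Og _] := oracle_exact hO x.
by exists (f x, g), x => //; rewrite subrr -(scale0r x) (norm_scale hN) normr0 mul0r.
Qed.

(* Planes that are almost active at [x + t d] have slopes almost nonnegative
   along [d] and, as [t -> 0], intercepts tending to [f x]; axiom O2 then puts
   the limits of their slopes in the Clarke subdifferential. *)
Lemma clarke_ascent x d (L t0 K : R) :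
  0 <= M -> (forall p, oracle_planes x p -> `|p.2| <= L) -> 0 < t0 -> 0 <= K ->
  (forall t, 0 < t -> t <= t0 ->
     f x <= model1 (oracle_planes x) x (x + t *: d) + t ^+ 2 * K) ->
  exists2 g, (clarke_subdiff f x `&` [set g | `|g| <= L]) g & 0 <= dot g d.
Proof.
move=> M0 LP t00 K0 fle.
pose t (j : nat) := t0 * harmonic j.
have t_gt0 j : 0 < t j by rewrite mulr_gt0// invr_gt0 ltr0n.
have t_le j : t j <= t0 by rewrite (ler_piMr (ltW t00))// /harmonic/= invf_le1 ?ltr0n// ler1n.
have t_cvg : t j @[j --> \oo] --> (0 : R).
  by rewrite -(mulr0 t0); apply: cvgMr; exact: cvg_harmonic.
(* The supremum need not be attained; the extra 1 in [K + 1] allows a slack of [t j ^+ 2],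
   negligible after division by [t j]. *)
have /choice[p pP] j : exists p, oracle_planes x p /\
    f x - t j ^+ 2 * (K + 1) <= eval_plane x p (x + t j *: d).
  have hs : has_sup [set eval_plane x p (x + t j *: d) | p in oracle_planes x].
    split; last exact: oracle_planes_eval_bounded.
    by have [p Pp] := oracle_planes_nonempty x M0; exists (eval_plane x p (x + t j *: d)), p.
  have [_ [p Pp <-] pj] := sup_adherent (exprn_gt0 2 (t_gt0 j)) hs.
  exists p; split => //; have := fle _ (t_gt0 j) (t_le j).
  by move/ltW: pj; rewrite -/(model1 _ _ _); lra.
have {}pP j : [/\ exists2 z, N (z - x) <= M & O z x (p j), (p j).1 <= f x,
    `|(p j).2| <= L & f x - t j ^+ 2 * (K + 1) <= (p j).1 + t j * dot (p j).2 d].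
  have [[z zM Oz] pj] := pP j; split.
  - by exists z.
  - by apply: (oracle_below hO (g := (p j).2)); rewrite -surjective_pairing; exact: Oz.
  - by apply: LP; exists z.
  - by move: pj; rewrite /eval_plane (addrC x) addrK dotZr.
have /choice[z zP] j : exists z, N (z - x) <= M /\ O z x (p j).
  by have [[z zM Oz] _ _ _] := pP j; exists z.
have [|s [g [sm sg]]] := @bounded_seq_cvg_subseq _ _ (fun j => (p j).2) L.
  by move=> j; have [] := pP j.
have ts_le m : t (s m) <= t m.
  by rewrite ler_pM2l// lef_pV2 ?posrE ?ltr0n// ler_nat ltnS.
exists g; first split.
- apply: (oracle_O2 hO (z_ := z \o s) (a_ := fun m => (p (s m)).1)
    (g_ := fun m => (p (s m)).2)) => //.
  + by move=> j; rewrite -surjective_pairing; exact: (zP (s j)).2.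
  (* [t m * b] bounds the possible gap between the intercept and [f x]: the first term covers the
     quadratic error, the second the slope along [d]. *)
  + pose b := t0 * (K + 1) + n%:R * (L * `|d|).
    apply: (@squeeze_cvgr _ _ _ _ (fun m => f x - t m * b) (cst (f x))); last 2 first.
    * rewrite -[X in _ --> X]subr0 -(mul0r b); apply: cvgB; first exact: cvg_cst.
      exact: cvgMl t_cvg.
    * exact: cvg_cst.
    apply: nearW => m; have [_ -> pL pm] := pP (s m); rewrite andbT.
    have := dot_le (p (s m)).2 d.
    have : n%:R * (`|(p (s m)).2| * `|d|) <= n%:R * (L * `|d|).
      by rewrite ler_wpM2l// ler_wpM2r.
    have := t_gt0 (s m); have := t_le (s m); have := ts_le m.
    have L0 : 0 <= n%:R * (L * `|d|).
      by rewrite !mulr_ge0// (le_trans _ pL).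
    rewrite /b; move: (t m) (t (s m)) L0 pm; move: (n%:R * _) => c t1 t2 c0.
    move: (dot _ _) (n%:R * _) => e c' pm h1 h2 h3 h4 h5.
    have h6 : t2 * e <= t1 * c by nra.
    have h7 : t2 ^+ 2 * (K + 1) <= t1 * (t0 * (K + 1)).
      by rewrite mulrA ler_wpM2r ?addr_ge0// expr2; nra.
    by rewrite mulrDr; lra.
  + by move=> j; exact: (zP (s j)).1.
- apply: (ler_cvg_to (cvg_norm sg) (cvg_cst L)); apply: nearW => m.
  by have [] := pP (s m).
- have cd : dot (p (s m)).2 d @[m --> \oo] --> dot g d.
    exact: (@cvg_dot _ _ _ _ _ _ _ _ _ sg (cvg_cst _)).
  (* The intercept is at most [f x], so it cancels, and division by [t (s m)] bounds the slope along
     [d] below by this vanishing sequence. *)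
  have ct : - (t m * (K + 1)) @[m --> \oo] --> (0 : R).
    by rewrite -oppr0 -(mul0r (K + 1)); apply: cvgN; exact: cvgMl t_cvg.
  apply: (ler_cvg_to ct cd); apply: nearW => m.
  have [_ p1 _ pm] := pP (s m).
  have := t_gt0 (s m); have := ts_le m; move: p1 pm.
  move: (t m) (t (s m)) (dot _ _) => t1 t2 e h1 h2 h3 h4.
  have : 0 <= t2 * (e + t2 * (K + 1)) by lra.
  rewrite pmulr_rge0//; nra.
Qed.

End OracleEnvelope.

(** Otherwise the sequence would grow at least linearly. *)
Lemma exists_small_increment {R : realType} (s : nat -> R) (b e : R) :
  (forall k, s k <= b) -> 0 < e -> exists k, s k.+1 - s k < e.
Proof.
move=> sb e0; apply: contrapT => /forallNP H.
have sk k : s 0%N + k%:R * e <= s k.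
  elim: k => [|k IH]; first by rewrite mul0r addr0.
  by have /negP := H k; rewrite -leNgt -natr1 => Hk; lra.
have := archi_boundP (ltW (divr_gt0 (ltr_pwDl ltr01 (normr_ge0 (b - s 0%N))) e0)).
rewrite ltr_pdivrMr//; set k := Num.bound _ => bk.
have := sk k; have := sb k; have := ler_norm (b - s 0%N); lra.
Qed.

(** * Convergence of the tangent program values in the inner loop *)

Section InnerLoop.
Context {R : realType} {n : nat} {N : 'rV[R]_n -> R} {f : 'rV[R]_n -> R}
  {C : set 'rV[R]_n} {M : R} {O : 'rV[R]_n -> 'rV[R]_n -> set (R * 'rV[R]_n)}
  {gamma gammat theta Theta : R} {x : 'rV[R]_n} {Q : 'M[R]_n}
  {r : nat -> R} {W : nat -> set (plane R n)} {y g z : nat -> 'rV[R]_n} {r0 : R}.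
Context (hN : is_norm N) (hM : 0 <= M) (hO : cutting_plane_oracle N M f O)
  (hgammat1 : gammat < 1) (hx : C x) (hQ : posdef Q)
  (hloop : infinite_inner_loop N M f C O gamma gammat theta Theta Q x r W y g z)
  (hr0 : 0 < r0) (hr : forall k, r0 <= r k) (hzy : forall k, z k = y k).

Local Notation P := (@oracle_planes _ _ N M O x).
Local Notation phi k := (model1 (W k) x).
Let S k := model2 (W k) Q x (y k).

Let r_gt0 k : 0 < r k. Proof. exact: lt_le_trans (hr k). Qed.

Let y_in k : C (y k). Proof. by have [] := loop_tangent hloop k. Qed.

Let y_radius k : N (y k - x) <= r k. Proof. by have [] := loop_tangent hloop k. Qed.

Let y_M k : N (y k - x) <= M. Proof. by rewrite -hzy; exact: (loop_M hloop k). Qed.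

Let r_noninc k : r k.+1 <= r k.
Proof. by rewrite (loop_radius hloop); case: ifP => _ //; have := r_gt0 k; lra. Qed.

Let Nxx : N (x - x) = 0.
Proof. by rewrite subrr -(scale0r x) (norm_scale hN) normr0 mul0r. Qed.

Let exact_oracle p : exactness_planes f O x p -> p.1 = f x /\ P p.
Proof. by move=> [p1 Op]; split => //; exists x; rewrite ?Nxx. Qed.

Let exact_in k : exists p, [/\ W k p, p.1 = f x & P p].
Proof.
have [p [ep Wp]] : exactness_planes f O x `&` W k !=set0.
  case: k => [|k]; first exact: (loop_W0_exact hloop).
  by have [] := loop_null_step hloop k.
by have [p1 Pp] := exact_oracle p ep; exists p.
Qed.

Let aggregate_le k u : C u ->
  eval_plane x (aggregate_plane (W k) x (y k) (g k)) u <= phi k u.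
Proof.
by move=> Cu; have [ag _] := loop_aggregate hloop k; exact: aggregate_plane_le ag (y_in k) Cu.
Qed.

(* An aggregate plane is a minorant of the model only on [C], whence the
   restriction on [u]. *)
Lemma loop_plane_le_envelope k p u : W k p -> C u -> eval_plane x p u <= model1 P x u.
Proof.
have PleE q : P q -> eval_plane x q u <= model1 P x u.
  exact: (model1_ge _ _ _ _ (oracle_planes_eval_bounded hN hO x u)).
move=> + Cu; elim: k p => [|k IH] p Wp; first by apply/PleE/(loop_W0_oracle hloop).
have [_ _ _ /(_ p Wp)[[[|->]|Op]|]] := loop_null_step hloop k.
- by move=> /exact_oracle[_ /PleE].
- apply: le_trans (aggregate_le k u Cu) _; apply: model1_le; last exact: IH.
  by have [q [Wq _ _]] := exact_in k; exists q.
- by apply: PleE; exists (z k) => //; exact: (loop_M hloop k).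
- exact: IH.
Qed.

(** The real supremum in [model1] is meaningful only for sets bounded above; on [C] the envelope
    supplies the bound. *)
Let W_le k p u : W k p -> C u -> eval_plane x p u <= phi k u.
Proof.
move=> Wp Cu; apply: model1_ge => //.
by exists (model1 P x u) => _ [q Wq <-]; exact: (loop_plane_le_envelope _ _ _ Wq Cu).
Qed.

Let W_nonempty k : W k !=set0.
Proof. by have [p [Wp _ _]] := exact_in k; exists p. Qed.

Let phi_le_envelope k u : C u -> phi k u <= model1 P x u.
Proof.
by move=> Cu; apply: model1_le => // p Wp; exact: (loop_plane_le_envelope _ _ _ Wp Cu).
Qed.

Lemma loop_model_base k : phi k x = f x.
Proof.
apply/eqP; rewrite eq_le; apply/andP; split.
  apply: le_trans (phi_le_envelope k x hx) _; apply: model1_le.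
    exact: (oracle_planes_nonempty hN hO x hM).
  move=> p [u _ Op]; rewrite eval_plane_base.
  by apply: (oracle_below hO (g := p.2)); rewrite -surjective_pairing; exact: Op.
have [p [Wp <- _]] := exact_in k.
by rewrite -(eval_plane_base x p); exact: W_le.
Qed.

Lemma loop_value_le k : S k <= f x.
Proof.
have [_ _ /(_ x hx)] := loop_tangent hloop k.
rewrite Nxx => /(_ (ltW (r_gt0 k))) /le_trans; apply.
by rewrite /model2 subrr quad0 mulr0 addr0 loop_model_base.
Qed.

(* Testing the normal vector [v] of the trust region ball at [x + (r / N v) v]
   bounds [v] by the model decrease divided by the radius. *)
Lemma aggregate_bounded : exists2 L, 0 <= L & forall k, `|g k| <= L.
Proof.
have [L L0 LP] := oracle_planes_bounded hN hO x.
have [c c0 cN] := sup_le_norm hN.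
have [c' c'0 Nc'] := norm_le_sup hN.
have [cQ cQ0 QcQ] := norm_mulmx_le Q^T.
pose D := M / c.
have yD k : `|y k - x| <= D by rewrite ler_pdivlMr// mulrC (le_trans (cN _)).
have D0 : 0 <= D by exact: (le_trans _ (yD 0%N)).
pose B := n%:R * (L * D).
have B0 : 0 <= B := mulr_ge0 (ler0n _ _) (mulr_ge0 L0 D0).
exists (cQ * D + c' * B / r0).
  by rewrite addr_ge0 ?mulr_ge0// invr_ge0 ltW.
move=> k.
have [ag [v [_ vP] gv]] := loop_aggregate hloop k.
have gE : g k = - ((y k - x) *m Q^T) - v.
  by apply/subr0_eq; rewrite -gv opprD !opprK addrA.
rewrite gE (le_trans (ler_normB _ _))// normrN lerD//.
  by rewrite (le_trans (QcQ _))// ler_wpM2l.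
have [->|v0] := eqVneq v 0.
  by rewrite normr0 !mulr_ge0// invr_ge0 ltW.
have Nv : 0 < N v.
  rewrite lt_neqAle (norm_ge0 hN) andbT eq_sym.
  by apply: contra_neq v0 => /(norm_eq0 hN).
(* Since [v = - g k - Q (y k - x)], this product is at most [f x - phi k (y k)], which an exactness
   plane bounds by [B]. *)
have vd : dot v (y k - x) <= B.
  have := aggregate_le k x hx; rewrite eval_aggregate_plane loop_model_base.
  have [p [Wp p1 Pp]] := exact_in k.
  have := W_le k p (y k) Wp (y_in k); rewrite /eval_plane p1.
  have := dot_le (- p.2) (y k - x); rewrite normrN dotNl.
  have : n%:R * (`|p.2| * `|y k - x|) <= B.
    by rewrite ler_wpM2l// ler_pM// (LP p Pp).2.
  have : 0 <= quad Q (y k - x).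
    have [->|d0] := eqVneq (y k - x) 0; first by rewrite quad0.
    by rewrite ltW//; exact: hQ.2.
  rewrite gE hQ.1 quadE -(opprB (y k) x); move: (y k - x) => d.
  rewrite !dot_linear; lra.
have : dot v (x + (r k / N v) *: v - y k) <= 0.
  apply: vP; rewrite /nball/= (addrC x) addrK (norm_scale hN).
  by rewrite gtr0_norm ?divr_gt0// divfK// gt_eqF.
rewrite (_ : _ - y k = (r k / N v) *: v - (y k - x)); last first.
  by rewrite opprB addrA (addrC x).
rewrite dotBr dotZr subr_le0 mulrAC ler_pdivrMr// => h.
rewrite ler_pdivlMr//.
(* The chain is [r0 * |v|^2 <= r k * dot v v <= B * N v <= B * c' * |v|], after which [|v|]
   cancels. *)
have h1 := sqr_norm_le_dot v.
have h2 : r0 * `|v| ^+ 2 <= r k * dot v v.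
  by apply: ler_pM => //; exact: ltW.
have h3 : dot v (y k - x) * N v <= B * (c' * `|v|).
  by apply: le_trans (_ : B * N v <= _); [rewrite ler_wpM2r// ltW|rewrite ler_wpM2l].
rewrite -(ler_pM2r (_ : 0 < `|v|)) ?normr_gt0//.
rewrite expr2 in h2; lra.
Qed.

Lemma loop_slope_bounded : exists2 L, 0 <= L &
  forall k p, W k p -> `|p.2| <= L.
Proof.
have [L L0 LP] := oracle_planes_bounded hN hO x.
have [L' L'0 L'g] := aggregate_bounded.
have PL p : P p -> `|p.2| <= L + L'.
  by move=> /LP[_ pL]; rewrite (le_trans pL)// lerDl.
exists (L + L') => [|k]; first exact: addr_ge0.
elim: k => [|k IH] p Wp; first by apply/PL/(loop_W0_oracle hloop).
have [_ _ _ /(_ p Wp)[[[|->]|Op]|]] := loop_null_step hloop k.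
- by move=> /exact_oracle[_ /PL].
- by rewrite /= (le_trans (L'g k))// lerDr.
- by apply: PL; exists (z k) => //; exact: (loop_M hloop k).
- exact: IH.
Qed.

(** The aggregate plane minorises the next model on [C]. The first order change of value along it is
    [- dot v (y k.+1 - y k)], nonnegative because radii never grow and so [y k.+1] lies in the old
    ball; the quadratic term is what remains. *)
Lemma loop_value_increase k : S k + 2^-1 * quad Q (y k.+1 - y k) <= S k.+1.
Proof.
have [_ Wag _ _] := loop_null_step hloop k.
have := W_le _ _ _ Wag (y_in k.+1); rewrite eval_aggregate_plane.
have [_ [v [_ vP] gv]] := loop_aggregate hloop k.
have := vP _ (le_trans (y_radius k.+1) (r_noninc k)).
have : dot (g k + (y k - x) *m Q + v) (y k.+1 - y k) = 0.
  by rewrite -[in _ *m Q]hQ.1 gv dotC dot0r.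
rewrite /S /model2 (_ : y k.+1 - x = (y k - x) + (y k.+1 - y k)); last first.
  by rewrite [RHS]addrC addrA subrK.
by rewrite (quadD _ (y k - x) (y k.+1 - y k) hQ.1) [dot (g k + _ + v) _]dotDl [dot (g k + _) _]dotDl; lra.
Qed.

(** One index is enough, as the values [S k] never decrease. *)
Lemma loop_value_cvg (e : R) : 0 < e -> exists k, f x - S k < e.
Proof.
move=> e0; apply: contrapT => /forallNP H.
have {}H k : e <= f x - S k by have /negP := H k; rewrite -leNgt.
have [c c0 cQ] := posdef_coercive hQ.
have [L L0 WL] := loop_slope_bounded.
pose K := n%:R * L.
have K0 : 0 <= K by rewrite /K mulr_ge0.
pose eta := (1 - gammat) * e.
have eta0 : 0 < eta by rewrite /eta mulr_gt0// subr_gt0.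
pose kappa := eta / (2 * (K + 1)).
have kappa0 : 0 < kappa by rewrite /kappa divr_gt0// mulr_gt0// ltr_wpDl.
have cK : 0 < c * kappa ^+ 2 / 2 by rewrite divr_gt0// mulr_gt0// exprn_gt0.
(* Subtracting [r k] controls values and radii at once. The threshold [r0 / 2] rules out halving,
   [eta / 2] bounds the gain in value, and the last one makes the step shorter than [kappa]. *)
have [||k] := @exists_small_increment R (fun k => S k - r k) (f x)
  (Num.min (r0 / 2) (Num.min (eta / 2) (c * kappa ^+ 2 / 2))).
- by move=> k; have := loop_value_le k; have := r_gt0 k; lra.
- by rewrite !lt_min !divr_gt0//= mulr_gt0// exprn_gt0.
rewrite !lt_min => /and3P[h1 h2 h3].
have h4 := loop_value_increase k.
have h5 := cQ (y k.+1 - y k).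
have h6 := r_noninc k.
have d2 : 0 <= c * `|y k.+1 - y k| ^+ 2 by rewrite mulr_ge0 ?sqr_ge0// ltW.
have h7 : f x - phi k.+1 (y k) < gammat * (f x - S k).
  have := loop_radius hloop k; case: ifP => [|_ rk]; last first.
    by have := hr k; rewrite rk in h1 h6; lra.
  rewrite /rho_tilde hzy -/(S k) ltr_pdivrMr//.
  exact: lt_le_trans (H k).
have h8 : phi k.+1 (y k) <= phi k.+1 (y k.+1) + K * `|y k.+1 - y k|.
  apply: model1_le => // p Wp; rewrite (eval_planeB _ _ _ (y k.+1)) lerD ?W_le//.
  rewrite (le_trans (dot_le _ _))// distrC /K -mulrA ler_wpM2l// ler_wpM2r//.
  exact: (WL _ _ Wp).
have h9 : phi k.+1 (y k.+1) <= S k.+1.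
  rewrite /S /model2 lerDl mulr_ge0// (le_trans _ (cQ _))//.
  by rewrite mulr_ge0 ?sqr_ge0// ltW.
have h10 : `|y k.+1 - y k| < kappa.
  rewrite -(ltr_pXn2r (_ : (0 < 2)%N)) ?nnegrE//; last exact: ltW.
  by rewrite -(ltr_pM2l c0); lra.
have h11 : K * `|y k.+1 - y k| <= eta / 2.
  rewrite (_ : eta / 2 = (K + 1) * kappa); last first.
    by rewrite /kappa; field; rewrite gt_eqF// ltr_wpDl.
  by apply: ler_pM => //; [rewrite lerDl|exact: ltW].
(* The previous bounds give [phi k.+1 (y k) < S k + eta], which this inequality turns into a
   contradiction with [h7]. *)
have h12 : eta <= (1 - gammat) * (f x - S k) by rewrite ler_wpM2l// subr_ge0 ltW.
lra.
Qed.

(** Such a [u] is feasible in every tangent program, so each [S k] lies below the right-hand side;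
    then [S k] tends to [f x]. *)
Lemma envelope_ge u : C u -> N (u - x) <= r0 ->
  f x <= model1 P x u + 2^-1 * quad Q (u - x).
Proof.
move=> Cu ur; apply/ler_addgt0Pr => e /loop_value_cvg[k ke].
have [_ _ /(_ u Cu (le_trans ur (hr k)))] := loop_tangent hloop k.
have := phi_le_envelope k u Cu; rewrite -/(S k) /model2; lra.
Qed.

End InnerLoop.

(** * From the envelope inequality to criticality *)

Theorem lemma5p6 (R : realType) (n : nat)
  (N : 'rV[R]_n -> R) (hN : is_norm N)
  (f : 'rV[R]_n -> R) (hf : locally_lipschitz f)
  (C : set 'rV[R]_n) (hCclosed : closed C)
  (hCconvex : convex_set (C : set (convex_lmodType 'rV[R]_n)))
  (M : R) (hM : 0 < M)
  (O : 'rV[R]_n -> 'rV[R]_n -> set (R * 'rV[R]_n))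
  (hO : cutting_plane_oracle N M f O)
  (gamma gammat theta Theta q : R)
  (hgamma : 0 < gamma) (hgammat : gamma < gammat) (hgammat1 : gammat < 1)
  (htheta : 0 < theta) (htheta1 : theta < 1) (hTheta : 1 <= Theta)
  (hq : 0 < q)
  (x : 'rV[R]_n) (hx : C x)
  (Q : 'M[R]_n) (hQ : posdef Q) (hQq : op_norm N Q <= q)
  (r : nat -> R) (W : nat -> set (plane R n)) (y g z : nat -> 'rV[R]_n)
  (hloop : infinite_inner_loop N M f C O gamma gammat theta Theta Q x r W y g z)
  (hr : exists2 r0 : R, 0 < r0 & forall k, r0 <= r k)
  (hzy : forall k, z k = y k) :
  critical f C x.
Proof.
have [r0 r00 r0r] := hr.
have sC := convex_set_segment C hCconvex.
have M0 := ltW hM.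
have [L L0 LP] := oracle_planes_bounded hN hO x.
(* Cutting with a ball of radius [L], which contains all oracle slopes, gives the compact set that
   the selection argument requires. *)
suff [h [ch _] nh] : exists2 h, (clarke_subdiff f x `&` [set h | `|h| <= L]) h &
    normal_cone C x (- h).
  by exists h => //; exists (- h) => //; rewrite subrr.
apply: normal_selection => //.
- rewrite setIC; apply: compact_closedI; last exact: clarke_subdiff_closed.
  exact: compact_norm_ball.
- move=> h h' t [ch hL] [ch' hL'] t0 t1.
  split; first exact: clarke_subdiff_convex.
  rewrite /= (_ : _ + _ = (1 - t) *: h + t *: h'); last first.
    by rewrite scalerBr scalerBl scale1r addrA addrAC.
  rewrite (le_trans (ler_normD _ _))// !normrZ !ger0_norm ?subr_ge0//.
  move: hL hL' => /= hL hL'; nra.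
- move=> u Cu; pose d := u - x.
  have Nd := norm_ge0 hN d.
  have rNd : 0 < r0 + N d by rewrite ltr_pwDl.
  (* This bound on [t] ensures both [t <= 1], so that the point stays on the segment in [C], and
     [t * N d <= r0], so that it stays in every trust region. *)
  apply: (@clarke_ascent _ _ _ hN _ _ _ hO x d L (r0 / (r0 + N d)) (2^-1 * quad Q d)) => //.
  + by move=> p /LP[].
  + exact: divr_gt0.
  + rewrite mulr_ge0//; have [->|d0] := eqVneq d 0; first by rewrite quad0.
    by rewrite ltW//; exact: hQ.2.
  + move=> t t0; rewrite ler_pdivlMr// => tr.
    have xd : x + t *: d - x = t *: d by rewrite (addrC x) addrK.
    have tN : t * N d <= r0 by have := mulr_gt0 t0 r00; lra.
    have t1 : t <= 1.
      by rewrite -(ler_pM2r r00) mul1r; have := mulr_ge0 (ltW t0) Nd; lra.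
    have := envelope_ge hN M0 hO hgammat1 hx hQ hloop r00 r0r hzy (x + t *: d).
    rewrite xd quadZ (norm_scale hN) (gtr0_norm t0) mulrCA; apply => //.
    by apply: sC => //; exact: ltW.
Qed.
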